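(* Let $n\ge1$ and let $$\rho=\sum_{x\in\{0,1\}^n}p_x|x\rangle\langle x|+c\bigl(|0^n\rangle\langle1^n|+|1^n\rangle\langle0^n|\bigr),\qquad c\in\mathbb R,$$ be a density operator (so $p_x\ge0$, $\sum_xp_x=1$, $c^2\le p_{0^n}p_{1^n}$). Write $p_{\mathbf0}=p_{0^n}$, $p_{\mathbf1}=p_{1^n}$. Then $\rho\in\mathcal S$ if and only if $|c|\le\min(p_{\mathbf0},p_{\mathbf1})$, and $$\mathcal R(\rho)=1+2\max\{0,\ |c|-p_{\mathbf0},\ |c|-p_{\mathbf1}\}.$$
   Context: $\mathcal S$ is the $n$-qubit stabilizer polytope: the convex hull of the density matrices of pure stabilizer states $C|0^n\rangle$, $C$ an $n$-qubit Clifford unitary. The robustness of magic is $\mathcal R(\rho)=\min\{\sum_j|q_j|:\rho=\sum_jq_j\sigma_j,\ q_j\in\mathbb R,\ \sigma_j\in\mathcal S\}$. *)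

(* Defs.v *)
(* Complex numbers are R[i] = complex R for R : realType,
   i.e. exactly the field C when R is the (unique up to iso) complete
   archimedean ordered field. *)
From HB Require Import structures.
From mathcomp Require Import all_boot all_order all_algebra.
From mathcomp Require Import complex.
From mathcomp Require Import reals.
Set Implicit Arguments. Unset Strict Implicit. Unset Printing Implicit Defensive.
Import Order.TTheory GRing.Theory Num.Theory.
Local Open Scope ring_scope.
Local Open Scope complex_scope.

Section Qubits.
Variable R : realType.
Local Notation C := (complex R).

(* dimension of the n-qubit Hilbert space *)
Definition qdim (n : nat) : nat := (2 ^ n)%N.

Lemma qdim_gt0 n : (0 < qdim n)%N.
Proof. by rewrite /qdim expn_gt0. Qed.

(* computational basis index of |0^n> and |1^n>: a basis index
   x : 'I_(2^n) encodes the bit string with bit k equal to odd (x %/ 2^k),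
   so 0^n is index 0 and 1^n is index 2^n - 1. *)
Definition idx0 (n : nat) : 'I_(qdim n) := Ordinal (qdim_gt0 n).
Lemma qdim_pred_lt n : ((qdim n).-1 < qdim n)%N.
Proof. by rewrite prednK // qdim_gt0. Qed.
Definition idx1 (n : nat) : 'I_(qdim n) := Ordinal (qdim_pred_lt n).

(* k-th bit of basis index x *)
Definition bit (x k : nat) : bool := odd (x %/ 2 ^ k).

(* conjugate transpose *)
Definition adj (m p : nat) (M : 'M[C]_(m, p)) : 'M[C]_(p, m) :=
  \matrix_(i, j) (M j i)^*.

(* single-qubit Pauli matrices I, X, Y, Z (entries indexed by bits) *)
Definition pauli1 (a : 'I_4) (r s : bool) : C :=
  match val a with
  | 0 => if r == s then 1 else 0                       (* I *)
  | 1 => if r == s then 0 else 1                       (* X *)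
  | 2 => if r == s then 0 else (if r then 'i else - 'i) (* Y *)
  | _ => if r == s then (if r then -1 else 1) else 0   (* Z *)
  end.

(* n-qubit Pauli operator  sigma_{a_0} (x) ... (x) sigma_{a_{n-1}} *)
Definition pauli (n : nat) (a : 'I_n -> 'I_4) : 'M[C]_(qdim n) :=
  \matrix_(x, y) \prod_(k < n) pauli1 (a k) (bit x k) (bit y k).

Definition unitary (n : nat) (U : 'M[C]_(qdim n)) : Prop :=
  U *m adj U = 1%:M.

(* Clifford unitaries: unitaries normalizing the Pauli group
   { i^k P_a } *)
Definition clifford (n : nat) (U : 'M[C]_(qdim n)) : Prop :=
  unitary U /\
  forall a : 'I_n -> 'I_4, exists (k : nat) (b : 'I_n -> 'I_4),
    U *m pauli a *m adj U = ('i ^+ k) *: pauli b.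

(* density matrix of the stabilizer state U|0^n> *)
Definition stab_dm (n : nat) (U : 'M[C]_(qdim n)) : 'M[C]_(qdim n) :=
  \matrix_(i, j) (U i (idx0 n) * (U j (idx0 n))^*).

(* the stabilizer polytope: convex hull of the stabilizer state densities *)
Definition in_stab_polytope (n : nat) (rho : 'M[C]_(qdim n)) : Prop :=
  exists (k : nat) (w : 'I_k -> C) (U : 'I_k -> 'M[C]_(qdim n)),
    (forall j, 0 <= w j) /\ \sum_(j < k) w j = 1 /\
    (forall j, clifford (U j)) /\
    rho = \sum_(j < k) w j *: stab_dm (U j).

(* r is the l1-norm of some real affine decomposition of rho into
   elements of the stabilizer polytope *)
Definition robust_decomp (n : nat) (rho : 'M[C]_(qdim n)) (r : C) : Prop :=
  exists (k : nat) (q : 'I_k -> C) (sigma : 'I_k -> 'M[C]_(qdim n)),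
    (forall j, q j \is Num.real) /\
    (forall j, in_stab_polytope (sigma j)) /\
    rho = \sum_(j < k) q j *: sigma j /\
    r = \sum_(j < k) `|q j|.

(* r is the robustness of magic of rho, i.e. the minimum of the above *)
Definition is_robustness (n : nat) (rho : 'M[C]_(qdim n)) (r : C) : Prop :=
  robust_decomp rho r /\ forall r', robust_decomp rho r' -> r <= r'.

(* rho = sum_x p_x |x><x| + c (|0^n><1^n| + |1^n><0^n|) *)
Definition rho_pc (n : nat) (p : 'I_(qdim n) -> R) (c : R) : 'M[C]_(qdim n) :=
  \sum_(x < qdim n) (p x)%:C *: delta_mx x x
  + c%:C *: (delta_mx (idx0 n) (idx1 n) + delta_mx (idx1 n) (idx0 n)).

End Qubits.

(* Main.v *)
Require Import Defs.
From HB Require Import structures.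
From mathcomp Require Import all_boot all_order all_algebra.
From mathcomp Require Import complex ring lra.
From mathcomp Require Import reals.
Set Implicit Arguments. Unset Strict Implicit. Unset Printing Implicit Defensive.
Import Order.TTheory GRing.Theory Num.Theory.
Local Open Scope ring_scope.
Local Open Scope complex_scope.

(* Any two nonzero amplitudes of a stabilizer state have the same modulus. Hence on
   stabilizer states, and by convexity on the polytope, the functional
   sigma |-> tr sigma + s (sigma_01 + sigma_10) - 2 sigma_00 with s = sgn c
   (0, 1 standing for 0^n, 1^n) takes values in [-1, 1]; on rho it is
   1 + 2 (|c| - p_0), which bounds the robustness from below, and the same holds with
   the roles of 0^n and 1^n exchanged. Conversely
   rho = 2|c| GHZ_s + sum_x (p_x - |c| [x = 0^n or x = 1^n]) |x><x|,
   where c^2 <= p_0 p_1 makes at most one coefficient negative, so this decomposition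
   attains the bound and is convex when |c| <= min (p_0, p_1). *)

(** * Basis indices as bit strings *)

Lemma bit_inj (n x y : nat) : (x < 2 ^ n)%N -> (y < 2 ^ n)%N ->
  (forall k, (k < n)%N -> bit x k = bit y k) -> x = y.
Proof.
elim: n x y => [|n IHn] x y; first by rewrite expn0 !ltnS !leqn0 => /eqP-> /eqP->.
rewrite expnS => ltx lty eq_bit.
have eq_half : x./2 = y./2.
  apply: IHn => [||k ltkn]; rewrite ?ltn_half_double -?mul2n //.
  have := eq_bit k.+1 ltkn.
  by rewrite /bit expnS !divnMA !divn2.
have := eq_bit 0%N isT; rewrite /bit expn0 !divn1 => eq_odd.
by rewrite -[x]odd_double_half -[y]odd_double_half eq_odd eq_half.
Qed.

(** A finite function, so that sums over basis indices can be reindexed by bit strings and split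
    qubit by qubit. *)
Definition bits (n : nat) (x : 'I_(qdim n)) : {ffun 'I_n -> bool} :=
  [ffun k : 'I_n => bit x k].

Lemma bits_inj (n : nat) : injective (@bits n).
Proof.
move=> x y /ffunP eq_xy; apply: val_inj.
apply: (@bit_inj n); [exact: ltn_ord | exact: ltn_ord | move=> k ltkn].
by have := eq_xy (Ordinal ltkn); rewrite !ffunE.
Qed.

Lemma bits_bij (n : nat) : bijective (@bits n).
Proof.
apply: inj_card_bij; first exact: bits_inj.
by rewrite card_ffun card_bool !card_ord.
Qed.

Lemma bit_idx0 (n k : nat) : bit (idx0 n) k = false.
Proof. by rewrite /bit div0n. Qed.

Lemma bit_idx1 (n k : nat) : (k < n)%N -> bit (idx1 n) k = true.
Proof.
rewrite /bit /= /qdim; elim: n k => // n IHn [|k] ltkn.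
  by rewrite divn1 expnS mul2n -subn1 oddB ?double_gt0 ?expn_gt0 // odd_double.
rewrite [(2 ^ k.+1)%N]expnS divnMA divn2.
(* Dropping the lowest bit of 2^(n+1) - 1 leaves 2^n - 1. *)
suff -> : (2 ^ n.+1).-1./2 = (2 ^ n).-1 by exact: IHn.
have := expn_gt0 2 n; case: (2 ^ n)%N (expnS 2 n) => // m -> _.
by rewrite mul2n doubleS /= uphalf_double.
Qed.

(** * Single-qubit Pauli algebra *)

Section Pauli1.
Variable R : realType.
Local Notation C := (complex R).

Definition pauli1_mul (a b : 'I_4) : 'I_4 :=
  match val a, val b with
  | 0, _ => b | _, 0 => a
  | 1, 1 => inord 0 | 1, 2 => inord 3 | 1, _ => inord 2
  | 2, 1 => inord 3 | 2, 2 => inord 0 | 2, _ => inord 1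
  | _, 1 => inord 2 | _, 2 => inord 1 | _, _ => inord 0
  end.

(** Exponent of i in a product: XY = iZ and its cyclic shifts give 1, the reversed products give 3,
    as -i = i^3. *)
Definition pauli1_phase (a b : 'I_4) : nat :=
  match val a, val b with
  | 1, 2 | 2, 3 | 3, 1 => 1
  | 2, 1 | 3, 2 | 1, 3 => 3
  | _, _ => 0
  end.

(** True exactly when the two matrices anticommute, so that it can serve as an exponent of -1. *)
Definition pauli1_comm (a b : 'I_4) : bool :=
  [&& val a != 0, val b != 0 & a != b]%N.

Lemma pauli1_mulE (a b : 'I_4) (r s : bool) :
  \sum_(t : bool) pauli1 R a r t * pauli1 R b t s =
  'i%R ^+ pauli1_phase a b * pauli1 R (pauli1_mul a b) r s.
Proof.
have i2 : 'i%R * 'i%R = -1 :> C by rewrite -expr2 sqrCi.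
rewrite big_bool /pauli1 /pauli1_mul /pauli1_phase !complexiE.
case: a => [[|[|[|[|//]]]] ha]; case: b => [[|[|[|[|//]]]] hb] /=;
  case: r; case: s; rewrite /= ?inordK //=;
  rewrite ?exprS ?expr0 ?mulr0 ?mul0r ?mulr1 ?mul1r ?addr0 ?add0r //;
  by rewrite ?(mulrN, mulNr, i2, opprK, mulr1, mul1r).
Qed.

Lemma pauli1_comm_mulE (a b : 'I_4) (r s : bool) :
  \sum_(t : bool) pauli1 R a r t * pauli1 R b t s =
  (-1) ^+ pauli1_comm a b * \sum_(t : bool) pauli1 R b r t * pauli1 R a t s.
Proof.
rewrite !big_bool /pauli1 /pauli1_comm !complexiE -!(inj_eq val_inj).
case: a => [[|[|[|[|//]]]] ha]; case: b => [[|[|[|[|//]]]] hb] /=;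
  case: r; case: s; rewrite /= ?expr1 ?expr0; ring.
Qed.

Lemma pauli1_sqr (a : 'I_4) (r s : bool) :
  \sum_(t : bool) pauli1 R a r t * pauli1 R a t s = (r == s)%:R.
Proof.
have i2 : 'i%R * 'i%R = -1 :> C by rewrite -expr2 sqrCi.
rewrite big_bool /pauli1 !complexiE.
case: a => [[|[|[|[|//]]]] ha] /=; case: r; case: s => /=;
  by rewrite ?mulr0 ?mul0r ?mulr1 ?addr0 ?add0r ?mulrN ?mulNr ?i2 ?mulr1 ?opprK ?mul0r ?oppr0 ?addr0.
Qed.

Lemma pauli1_conj (a : 'I_4) (r s : bool) :
  (pauli1 R a s r)^* = pauli1 R a r s.
Proof.
rewrite /pauli1 -!complexiE; apply/eqP.
by case: a => [[|[|[|[|//]]]] ha] /=; case: r; case: s;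
   rewrite eq_complex /= ?oppr0 ?opprK !eqxx.
Qed.

(** The X component in the symplectic encoding: X and Y flip the bit, I and Z keep it. *)
Definition xpart (a : 'I_4) : bool := (val a == 1)%N || (val a == 2)%N.

Lemma norm_pauli1 (a : 'I_4) (r s : bool) :
  `|pauli1 R a r s| = (r (+) s == xpart a)%:R.
Proof.
rewrite /pauli1 /xpart !complexiE.
by case: a => [[|[|[|[|//]]]] ha] /=; case: r; case: s => /=;
   rewrite ?normrN ?normCi ?normr1 ?normr0.
Qed.

End Pauli1.

(** * Products and entries of n-qubit Pauli operators *)

Section Pauli.
Variables (R : realType) (n : nat).
Local Notation C := (complex R).
Implicit Types (a b : 'I_n -> 'I_4) (x y z : 'I_(qdim n)).

Lemma eq_bits x y : (x == y) = [forall k : 'I_n, bit x k == bit y k].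
Proof.
rewrite -(inj_eq (@bits_inj n)); apply/eqP/forallP => [/ffunP eq_xy k | eq_xy].
  by have := eq_xy k; rewrite !ffunE => ->.
by apply/ffunP => k; rewrite !ffunE; apply/eqP.
Qed.

Lemma prod_natr (P : pred 'I_n) :
  \prod_(k < n) (P k)%:R = [forall k, P k]%:R :> C.
Proof.
have [/forallP allP | /forallPn[k /negbTE Pk]] := boolP [forall k, P k].
  by apply: big1 => k _; rewrite allP.
by rewrite (bigD1 k) //= Pk mul0r.
Qed.

(** The sum over the intermediate index runs over all bit strings, and a sum over functions of a
    product over qubits factors. *)
Lemma pauli_mul_entry a b x y :
  (pauli R a *m pauli R b) x y =
  \prod_(k < n) \sum_(t : bool) pauli1 R (a k) (bit x k) t * pauli1 R (b k) t (bit y k).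
Proof.
rewrite bigA_distr_bigA mxE (reindex (@bits n)); last first.
  by apply: onW_bij; exact: bits_bij.
by apply: eq_bigr => z _; rewrite !mxE -big_split; apply: eq_bigr => k _; rewrite ffunE.
Qed.

Lemma pauli_mul a b :
  pauli R a *m pauli R b =
  'i%R ^+ (\sum_(k < n) pauli1_phase (a k) (b k)) *:
    pauli R (fun k => pauli1_mul (a k) (b k)).
Proof.
apply/matrixP => x y; rewrite pauli_mul_entry !mxE expr_sum -big_split.
by apply: eq_bigr => k _; rewrite pauli1_mulE.
Qed.

Lemma pauli_sqr a : pauli R a *m pauli R a = 1%:M.
Proof.
apply/matrixP => x y; rewrite pauli_mul_entry !mxE eq_bits -prod_natr.
by apply: eq_bigr => k _; rewrite pauli1_sqr.
Qed.

Lemma pauli_comm a b :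
  pauli R a *m pauli R b =
  (-1) ^+ (\sum_(k < n) pauli1_comm (a k) (b k))%N *: (pauli R b *m pauli R a).
Proof.
apply/matrixP => x y; rewrite [RHS]mxE !pauli_mul_entry expr_sum -big_split.
by apply: eq_bigr => k _; rewrite pauli1_comm_mulE.
Qed.

Lemma adj_pauli a : adj (pauli R a) = pauli R a.
Proof.
apply/matrixP => x y; rewrite !mxE rmorph_prod.
by apply: eq_bigr => k _; exact: pauli1_conj.
Qed.

Lemma norm_pauli a x y :
  `|pauli R a x y| = [forall k : 'I_n, bit x k (+) bit y k == xpart (a k)]%:R.
Proof.
rewrite mxE normr_prod -prod_natr.
by apply: eq_bigr => k _; rewrite norm_pauli1.
Qed.

Lemma pauli_neq0P a x y :
  reflect (forall k : 'I_n, bit x k (+) bit y k = xpart (a k))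
          (pauli R a x y != 0).
Proof.
rewrite -normr_eq0 norm_pauli pnatr_eq0 eqb0 negbK.
by apply: (iffP forallP) => eq_xy k; apply/eqP.
Qed.

(** The bits of the column are forced: each is the bit of x, flipped where [xpart] holds. *)
Lemma pauli_row_uniq a x y z :
  pauli R a x y != 0 -> pauli R a x z != 0 -> y = z.
Proof.
move=> /pauli_neq0P xy /pauli_neq0P xz; apply/eqP; rewrite eq_bits.
by apply/forallP => k; apply/eqP/(@addbI (bit x k)); rewrite xy xz.
Qed.

Definition xpauli (f : 'I_n -> bool) : 'I_n -> 'I_4 := fun k => inord (f k).
Definition zpauli (f : 'I_n -> bool) : 'I_n -> 'I_4 := fun k => inord (3 * f k).

Lemma xpauli_idx0 (f : 'I_n -> bool) z x :
  (forall k : 'I_n, bit z k = f k) -> pauli R (xpauli f) x (idx0 n) = (x == z)%:R.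
Proof.
move=> def_z; rewrite mxE eq_bits -prod_natr; apply: eq_bigr => k _.
rewrite bit_idx0 def_z /xpauli /pauli1 /= inordK; last by case: (f k).
by case: (f k); case: (bit x k).
Qed.

Lemma zpauli_idx0 (f : 'I_n -> bool) x :
  pauli R (zpauli f) x (idx0 n) = (x == idx0 n)%:R.
Proof.
rewrite mxE eq_bits -prod_natr; apply: eq_bigr => k _.
rewrite bit_idx0 /zpauli /pauli1 /= inordK; last by case: (f k).
by case: (f k); case: (bit x k).
Qed.

(** The sum factors into a tensor power of I + Z = 2|0><0|. *)
Lemma sum_zpauli :
  \sum_(f : {ffun 'I_n -> bool}) pauli R (zpauli f) =
  2 ^+ n *: delta_mx (idx0 n) (idx0 n).
Proof.
apply/matrixP => x y; rewrite summxE !mxE.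
transitivity (\prod_(k < n) \sum_(t : bool)
    pauli1 R (inord (3 * t)) (bit x k) (bit y k)).
  by rewrite bigA_distr_bigA; apply: eq_bigr => f _; rewrite mxE.
transitivity (\prod_(k < n) (2 * (bit x k == false)%:R * (bit y k == false)%:R) : C).
  apply: eq_bigr => k _; rewrite big_bool /pauli1 /= !inordK //=.
  by case: (bit x k); case: (bit y k); rewrite /= ?addNr ?addr0 ?mulr1 ?mulr0.
rewrite !big_split /= prodr_const card_ord !prod_natr -mulrA -natrM mulnb.
by rewrite !eq_bits; congr (_ * (_ && _)%:R); apply: eq_forallb => k; rewrite bit_idx0.
Qed.

End Pauli.

(** * Clifford unitaries and amplitudes of stabilizer states *)

Section Stabilizer.
Variables (R : realType) (n : nat).
Local Notation C := (complex R).
Implicit Types (a b : 'I_n -> 'I_4) (x y z : 'I_(qdim n)) (U : 'M[C]_(qdim n)).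

Lemma signC_exp (k : nat) : (-1) ^+ k = 'i%R ^+ (2 * k) :> C.
Proof. by rewrite exprM sqrCi. Qed.

(** Paulis are self-adjoint involutions, so conjugation by one multiplies another by their
    commutation sign. *)
Lemma pauli_clifford a : clifford (pauli R a).
Proof.
split=> [|b]; first by rewrite /unitary adj_pauli pauli_sqr.
exists (2 * \sum_(k < n) pauli1_comm (a k) (b k))%N, b.
by rewrite adj_pauli pauli_comm -scalemxAl -mulmxA pauli_sqr mulmx1 signC_exp.
Qed.

(* Two anticommuting Paulis P, Q give a self-adjoint Clifford (P + (-1)^t Q) / sqrt 2:
   it maps R to (-1)^d R if P and Q both commute with R up to the sign (-1)^d,
   and to a multiple of R P Q otherwise. *)
Lemma pauli_sum_clifford a b (h : C) (t : nat) :
  conjc h = h -> 2 * (h * h) = 1 -> odd (\sum_(k < n) pauli1_comm (a k) (b k)) ->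
  clifford (h *: (pauli R a + (-1) ^+ t *: pauli R b)).
Proof.
move=> conj_h sqr_h anti; set U := h *: _.
have adjU : adj U = U.
  have adjD (M N : 'M[C]_(qdim n)) : adj (M + N) = adj M + adj N.
    by apply/matrixP => x y; rewrite !mxE rmorphD.
  have adjZ (z : C) (M : 'M[C]_(qdim n)) : adj (z *: M) = conjc z *: adj M.
    by apply/matrixP => x y; rewrite !mxE rmorphM.
  have conj_sign : conjc ((-1) ^+ t : C) = (-1) ^+ t.
    by rewrite [LHS]rmorphXn; congr (_ ^+ _); exact: rmorphN1.
  by rewrite /U !(adjZ, adjD) conj_h conj_sign !adj_pauli.
have sign2 (k : nat) : (-1) ^+ k * (-1) ^+ k = 1 :> C by rewrite -expr2 sqrr_sign.
have anti_ba : pauli R b *m pauli R a = - (pauli R a *m pauli R b).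
  by rewrite [in RHS]pauli_comm -signr_odd anti expr1 scaleN1r opprK.
(* Moving M to the left past both Paulis produces the factors d and e; expanding with PQ = -QP
   leaves a multiple of M and one of MPQ. *)
have conjU (M : 'M[C]_(qdim n)) (d e : C) :
    pauli R a *m M = d *: (M *m pauli R a) ->
    pauli R b *m M = e *: (M *m pauli R b) ->
    U *m M *m U = h * h * (d + e) *: M +
      h * h * (-1) ^+ t * (d - e) *: (M *m (pauli R a *m pauli R b)).
  set A := pauli R a; set B := pauli R b; set s := (-1) ^+ t => Ma Mb.
  have ss : s * s = 1 by exact: sign2.
  have AB_split : (d *: A + (s * e) *: B) *m (A + s *: B) =
      (d + e)%:M + (s * (d - e)) *: (A *m B).
    rewrite mulmxDl !mulmxDr -!scalemxAl -!scalemxAr !pauli_sqr anti_ba.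
    move: (A *m B) => AB; apply/matrixP => x y; rewrite !mxE.
    by case: (x == y); rewrite ?mulr1n ?mulr0n; ring: ss.
  have -> : U *m M *m U = (h * h) *: ((A + s *: B) *m M *m (A + s *: B)).
    by rewrite /U -!scalemxAl -scalemxAr scalerA.
  have -> : (A + s *: B) *m M = M *m (d *: A + (s * e) *: B).
    by rewrite mulmxDl -scalemxAl Ma Mb scalerA mulmxDr -!scalemxAr.
  rewrite -mulmxA AB_split.
  by rewrite mulmxDr mul_mx_scalar -scalemxAr scalerDr !scalerA !mulrA.
have U2 : U *m U = 1%:M.
  have := conjU 1%:M 1 1; rewrite !scale1r !mulmx1 !mul1mx => -> //.
  by rewrite subrr mulr0 scale0r addr0 mulrC sqr_h scale1r.
split=> [|c]; first by rewrite /unitary adjU.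
set d := (\sum_(k < n) pauli1_comm (a k) (c k))%N.
set e := (\sum_(k < n) pauli1_comm (b k) (c k))%N.
rewrite adjU (conjU _ ((-1) ^+ d) ((-1) ^+ e)) -?pauli_comm //.
rewrite -[_ ^+ d]signr_odd -[_ ^+ e]signr_odd.
have [eq_de|neq_de] := eqVneq (odd d) (odd e).
  exists (2 * odd e)%N, c; rewrite eq_de subrr mulr0 scale0r addr0 -signC_exp.
  by congr (_ *: _); ring: sqr_h.
have -> : odd d = ~~ odd e by move: neq_de; case: (odd d); case: (odd e).
rewrite signrN addNr mulr0 scale0r add0r mulmxA !pauli_mul -scalemxAl pauli_mul !scalerA.
(* Here d - e is twice a sign, and the 2 cancels against h^2 = 1/2. The exponent collects that sign,
   (-1)^t, and the phases of the two Pauli products. *)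
exists (2 * (t + ~~ odd e) + (\sum_(k < n) pauli1_phase (c k) (a k) +
  \sum_(k < n) pauli1_phase (pauli1_mul (c k) (a k)) (b k)))%N; eexists.
rewrite exprD -signC_exp !exprD signrN !mulrA; congr (_ * _ * _ *: _).
by rewrite -[RHS]mul1r -sqr_h; ring.
Qed.

Lemma clifford_adjl U : clifford U -> adj U *m U = 1%:M.
Proof. by case=> unitU _; exact: mulmx1C. Qed.

Lemma sum_norm_stab U : clifford U -> \sum_x `|U x (idx0 n)| ^+ 2 = 1.
Proof.
move=> /clifford_adjl /matrixP/(_ (idx0 n) (idx0 n)); rewrite !mxE eqxx mulr1n => <-.
by apply: eq_bigr => x _; rewrite mxE sqr_normc mulrC.
Qed.

Lemma stab_dmE U : stab_dm U = U *m delta_mx (idx0 n) (idx0 n) *m adj U.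
Proof.
apply/matrixP => x y; rewrite !mxE (bigD1 (idx0 n)) //= big1 ?addr0 => [|z nz0].
  rewrite !mxE (bigD1 (idx0 n)) //= big1 ?addr0 => [|z nz0]; rewrite !mxE ?eqxx ?mulr1 //.
  by rewrite (negbTE nz0) mulr0.
by rewrite !mxE big1 ?mul0r // => z' _; rewrite !mxE (negbTE nz0) andbF mulr0.
Qed.

(* Conjugating |0><0| = 2^-n sum_f Z_f by U writes the state as a sum of Paulis
   that stabilize u = U|0>. If u_x u_y^* != 0, one of them has a nonzero (x, y) entry,
   and as this is the only one in its row, u_x is u_y up to a phase. *)
Lemma stab_equal_modulus U x y : clifford U ->
  U x (idx0 n) != 0 -> U y (idx0 n) != 0 -> `|U x (idx0 n)| = `|U y (idx0 n)|.
Proof.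
move=> cliffU ux uy; have [unitU cU] := cliffU.
have sumE : 2 ^+ n *: stab_dm U =
    \sum_(f : {ffun 'I_n -> bool}) U *m pauli R (zpauli f) *m adj U.
  by rewrite stab_dmE -mulmx_suml -mulmx_sumr sum_zpauli -scalemxAr -scalemxAl.
have /eqP nz : (2 ^+ n *: stab_dm U) x y != 0.
  by rewrite !mxE !mulf_neq0 ?conjc_eq0 // expf_neq0 // pnatr_eq0.
have [f nzf] : exists f : {ffun 'I_n -> bool},
    (U *m pauli R (zpauli f) *m adj U) x y != 0.
  apply/existsP; apply: contra_notT nz => /existsPn all0.
  by rewrite sumE summxE big1 // => f _; apply/eqP; rewrite -[_ == _]negbK all0.
have [k [b defb]] := cU (zpauli f).
(* Read in column 0^n, where Z_f acts trivially, this says that the conjugated Pauli fixes u. *)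
have stab : (U *m pauli R (zpauli f) *m adj U) *m U = U *m pauli R (zpauli f).
  by rewrite -mulmxA clifford_adjl // mulmx1.
move: nzf stab; rewrite defb mxE mulf_eq0 negb_or => /andP[_ nzb].
move=> /matrixP/(_ x (idx0 n)); rewrite !mxE (bigD1 y) //= big1 ?addr0 => [|z nzy].
  rewrite (bigD1 (idx0 n)) //= big1 ?addr0 => [|z nz0].
    rewrite zpauli_idx0 eqxx mulr1 => <-.
    rewrite mxE !normrM normrX normCi expr1n mul1r norm_pauli.
    by move/pauli_neq0P: nzb => nzb; rewrite (introT forallP) ?mul1r // => i; rewrite nzb.
  by rewrite zpauli_idx0 (negbTE nz0) mulr0.
rewrite mxE; apply/eqP; rewrite !mulf_eq0; apply/orP; left; apply/orP; right.
by apply: contraNT nzy => nzz; apply/eqP/(pauli_row_uniq nzz nzb).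
Qed.

End Stabilizer.

(** * The scalar inequality behind the witness *)

Lemma norm_1B_le1 (F : numDomainType) (t : F) : 0 <= t -> t <= 2 -> `|1 - t| <= 1.
Proof.
move=> t_ge0 t_le2; rewrite real_ler_norml ?rpredB ?ger0_real //.
by rewrite gerBl t_ge0 andbT lerBrDr addrC lerBlDr.
Qed.

(* The expression is 1 - 2|a|^2 if a b = 0 and 1 - |a - (-1)^t b|^2 if |a| = |b|. *)
Lemma coherence_bound (F : numClosedFieldType) (a b : F) (t : nat) :
  `|a| ^+ 2 + `|b| ^+ 2 <= 1 -> (a != 0 -> b != 0 -> `|a| = `|b|) ->
  `|1 + (-1) ^+ t * (a * Num.conj b + b * Num.conj a) - 2 * (a * Num.conj a)| <= 1.
Proof.
move=> le1 eq_mod; set s := (-1) ^+ t.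
have ss : s * s = 1 by rewrite -expr2 sqrr_sign.
have [a0|a_neq0] := eqVneq a 0.
  by rewrite a0 rmorph0 !(mulr0, mul0r, addr0) subr0 normr1.
have [b0|b_neq0] := eqVneq b 0.
  rewrite b0 rmorph0 !(mulr0, mul0r, addr0) -normCK norm_1B_le1 //.
    by rewrite mulr_ge0 ?exprn_ge0.
  move: le1; rewrite b0 normr0 expr0n addr0 => le1.
  by rewrite -[leRHS]mulr1 ler_wpM2l.
have {}eq_mod := eq_mod a_neq0 b_neq0.
have -> : 1 + s * (a * Num.conj b + b * Num.conj a) - 2 * (a * Num.conj a) =
    1 - `|a - s * b| ^+ 2.
  have eq_sqr : a * Num.conj a = b * Num.conj b by rewrite -!normCK eq_mod.
  (* One copy of |a|^2 is traded for |b|^2 to complete the square. *)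
  have -> : 2 * (a * Num.conj a) = a * Num.conj a + s * s * (b * Num.conj b).
    by rewrite ss mul1r -eq_sqr mulr_natl mulr2n.
  by rewrite normCK rmorphB rmorphM /= rmorph_sign -/s; ring.
apply: norm_1B_le1; first by rewrite exprn_ge0.
have le_norm : `|a - s * b| <= `|a| + `|b|.
  by apply: (le_trans (ler_normB _ _)); rewrite normrM normr_sign mul1r.
apply: (le_trans (lerXn2r 2 _ _ le_norm)); rewrite ?nnegrE ?addr_ge0 //.
move: le1; rewrite -eq_mod => le1.
(* With equal moduli, (|a| + |b|)^2 = 2(|a|^2 + |b|^2), which is at most 2. *)
have -> : (`|a| + `|a|) ^+ 2 = 2 * (`|a| ^+ 2 + `|a| ^+ 2) by ring.
by rewrite -[leRHS]mulr1 ler_wpM2l.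
Qed.

(** * Witnesses and lower bounds on the robustness *)

Section Robustness.
Variables (R : realType) (n : nat).
Local Notation C := (complex R).
Implicit Types (x y z : 'I_(qdim n)) (U W : 'M[C]_(qdim n)).

Lemma mxtrace_stab_dm U : clifford U -> \tr (stab_dm U) = 1.
Proof.
move=> cliffU; rewrite -(sum_norm_stab cliffU).
by apply: eq_bigr => x _; rewrite mxE sqr_normc.
Qed.

Lemma stab_dm_in_polytope U : clifford U -> in_stab_polytope (stab_dm U).
Proof.
move=> cliffU; exists 1%N, (fun=> 1), (fun=> U).
by split=> [j|]; rewrite ?ler01 // !big_ord1 scale1r.
Qed.

Lemma mxtrace_mul_sum W (k : nat) (w : 'I_k -> C) (sigma : 'I_k -> 'M[C]_(qdim n)) :
  \tr (W *m \sum_(j < k) w j *: sigma j) = \sum_(j < k) w j * \tr (W *m sigma j).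
Proof.
rewrite mulmx_sumr raddf_sum; apply: eq_bigr => j _.
by rewrite -scalemxAr [LHS]mxtraceZ.
Qed.

Lemma polytope_witness W rho :
  (forall U, clifford U -> `|\tr (W *m stab_dm U)| <= 1) ->
  in_stab_polytope rho -> `|\tr (W *m rho)| <= 1.
Proof.
move=> Wle1 [k [w [U [w_ge0 [sum_w [cliffU ->]]]]]].
rewrite mxtrace_mul_sum -sum_w; apply: (le_trans (ler_norm_sum _ _ _)).
apply: ler_sum => j _; rewrite normrM ger0_norm //.
by rewrite -[leRHS]mulr1 ler_wpM2l // Wle1.
Qed.

(** Weak duality: by the triangle inequality each term contributes at most |q_j|, since the witness
    is bounded by 1 on the whole polytope. *)
Lemma robust_decomp_witness W rho r :
  (forall U, clifford U -> `|\tr (W *m stab_dm U)| <= 1) ->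
  robust_decomp rho r -> `|\tr (W *m rho)| <= r.
Proof.
move=> Wle1 [k [q [sigma [_ [sigmaS [-> ->]]]]]].
rewrite mxtrace_mul_sum; apply: (le_trans (ler_norm_sum _ _ _)).
apply: ler_sum => j _; rewrite normrM.
by rewrite -[leRHS]mulr1 ler_wpM2l // (polytope_witness Wle1).
Qed.

(** The Hermitian matrix whose trace pairing is the functional s = (-1)^t; x and y are kept free so
    that 0^n and 1^n can be taken in either order. *)
Definition coherence_witness (t : nat) x y : 'M[C]_(qdim n) :=
  1%:M + (-1) ^+ t *: (delta_mx x y + delta_mx y x) - 2 *: delta_mx x x.

Lemma mxtrace_delta_mul x y (M : 'M[C]_(qdim n)) : \tr (delta_mx x y *m M) = M y x.
Proof.
rewrite /mxtrace (bigD1 x) //= big1 ?addr0 => [|z nzx]; rewrite !mxE.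
  rewrite (bigD1 y) //= big1 ?addr0 => [|z' nzy]; rewrite !mxE ?eqxx ?mul1r //.
  by rewrite (negbTE nzy) andbF mul0r.
by apply: big1 => z' _; rewrite !mxE (negbTE nzx) mul0r.
Qed.

Lemma coherence_witnessE t x y (M : 'M[C]_(qdim n)) :
  \tr (coherence_witness t x y *m M) =
  \tr M + (-1) ^+ t * (M x y + M y x) - 2 * M x x.
Proof.
rewrite /coherence_witness mulmxBl mulmxDl mul1mx -!scalemxAl mulmxDl.
rewrite raddfB raddfD /= !mxtraceZ raddfD /= !mxtrace_delta_mul.
by rewrite [M y x + _]addrC.
Qed.

(** As x and y differ, normalization gives |u_x|^2 + |u_y|^2 <= 1, and nonzero amplitudes share
    their modulus, so [coherence_bound] applies. *)
Lemma coherence_witness_stab t x y U : x != y -> clifford U ->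
  `|\tr (coherence_witness t x y *m stab_dm U)| <= 1.
Proof.
move=> neq_xy cliffU; rewrite coherence_witnessE mxtrace_stab_dm // !mxE.
apply: coherence_bound; last exact: stab_equal_modulus.
rewrite -(sum_norm_stab cliffU) (bigD1 x) //= (bigD1 y) 1?eq_sym //= addrA lerDl.
by apply: sumr_ge0 => z _; rewrite exprn_ge0.
Qed.

Lemma idx0_neq_idx1 : (1 <= n)%N -> idx0 n != idx1 n.
Proof.
move=> n_gt0; rewrite -(inj_eq val_inj) /= eq_sym -lt0n -ltnS prednK ?qdim_gt0 //.
by rewrite /qdim -[1%N](expn0 2) ltn_exp2l.
Qed.

(** * The state and its explicit stabilizer decomposition *)

Lemma rho_pcE (p : 'I_(qdim n) -> R) (c : R) x y :
  rho_pc p c x y = (p x)%:C *+ (x == y) +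
    c%:C * (((x == idx0 n) && (y == idx1 n))%:R + ((x == idx1 n) && (y == idx0 n))%:R).
Proof.
rewrite /rho_pc !mxE summxE (bigD1 x) //= big1 ?addr0 => [|z nzx]; rewrite !mxE.
  by rewrite eqxx /= [y == x]eq_sym mulr_natr.
by rewrite [x == z]eq_sym (negbTE nzx) mulr0.
Qed.

Lemma mxtrace_rho_pc (p : 'I_(qdim n) -> R) (c : R) :
  (1 <= n)%N -> \tr (rho_pc p c) = (\sum_x p x)%:C.
Proof.
move=> n_gt0; rewrite rmorph_sum; apply: eq_bigr => x _; rewrite rho_pcE eqxx.
case: eqVneq => [->|_]; rewrite ?(negbTE (idx0_neq_idx1 n_gt0)) ?andbF;
  by rewrite addr0 mulr0 addr0.
Qed.

(** A basis state is obtained from |0^n> by X on the qubits whose bit is 1, which is a Pauli and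
    hence Clifford. *)
Lemma basis_stab_dm x :
  stab_dm (pauli R (xpauli (fun k : 'I_n => bit x k))) = delta_mx x x.
Proof.
apply/matrixP => i j; rewrite /stab_dm mxE !(xpauli_idx0 R (z := x)) // mxE.
by rewrite conjC_nat -natrM mulnb.
Qed.

(** The Clifford is (Z_0 + (-1)^t X...X) / sqrt 2, which sends |0^n> to (|0^n> + (-1)^t |1^n>) /
    sqrt 2. *)
Lemma ghz_stab (t : nat) : (1 <= n)%N ->
  exists2 U : 'M[C]_(qdim n), clifford U & stab_dm U = 2^-1 *:
    (delta_mx (idx0 n) (idx0 n) + delta_mx (idx1 n) (idx1 n) +
     (-1) ^+ t *: (delta_mx (idx0 n) (idx1 n) + delta_mx (idx1 n) (idx0 n))).
Proof.
move=> n_gt0.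
have [h conj_h sqr_h] : exists2 h : C, conjc h = h & 2 * (h * h) = 1.
  exists ((Num.sqrt 2 : R)^-1%:C); first exact: conjc_real.
  rewrite -rmorphM /= -invfM -expr2 sqr_sqrtr ?ler0n //.
  by rewrite -(rmorph_nat (real_complex R) 2) -rmorphM /= mulfV ?rmorph1 ?pnatr_eq0.
have hh : h * h = 2^-1 by apply: (mulfI (x := 2)); rewrite ?pnatr_eq0 // sqr_h mulfV ?pnatr_eq0.
pose U : 'M[C]_(qdim n) := h *: (pauli R (zpauli (fun k : 'I_n => k == 0 :> nat)) +
  (-1) ^+ t *: pauli R (xpauli (fun=> true))).
exists U.
  apply: pauli_sum_clifford => //.
  (* The two Paulis anticommute because they clash on qubit 0 only. *)
  rewrite (bigD1 (Ordinal n_gt0)) //= big1 => [|k].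
    by rewrite /pauli1_comm /xpauli /zpauli -(inj_eq val_inj) /= !inordK.
  rewrite -(inj_eq val_inj) /= => /negbTE k0.
  by rewrite /pauli1_comm /zpauli k0 /= inordK.
have entry i : U i (idx0 n) = h * ((i == idx0 n)%:R + (-1) ^+ t * (i == idx1 n)%:R).
  rewrite /U mxE [X in _ * X]mxE zpauli_idx0; congr (_ * (_ + _)).
  by rewrite mxE (xpauli_idx0 R (z := idx1 n)) // => k; rewrite bit_idx1.
have conj_entry j : Num.conj (U j (idx0 n)) = U j (idx0 n).
  rewrite entry rmorphM rmorphD rmorphM /= rmorph_sign !conjC_nat.
  by congr (_ * _); exact: conj_h.
clearbody U; apply/matrixP => i j.
rewrite /stab_dm mxE conj_entry !entry !mxE -hh -!mulnb !natrM.
have := sqrr_sign C t; move: ((-1) ^+ t) => s; rewrite expr2 => ss.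
ring: ss.
Qed.

Lemma rho_pc_decomp (p : 'I_(qdim n) -> R) (c : R) : (1 <= n)%N ->
  (forall x, 0 <= p x) -> \sum_x p x = 1 ->
  c ^+ 2 <= p (idx0 n) * p (idx1 n) ->
  exists (q : 'I_(qdim n).+1 -> R) (U : 'I_(qdim n).+1 -> 'M[C]_(qdim n)),
    [/\ forall j, clifford (U j),
        rho_pc p c = \sum_j (q j)%:C *: stab_dm (U j),
        \sum_j q j = 1,
        \sum_j `|q j| =
          1 + 2 * Num.max 0 (Num.max (`|c| - p (idx0 n)) (`|c| - p (idx1 n))) &
        `|c| <= Num.min (p (idx0 n)) (p (idx1 n)) -> forall j, 0 <= q j].
Proof.
move=> n_gt0 p_ge0 sum_p le_c.
have neq01 := idx0_neq_idx1 n_gt0.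
have [t ct] : exists t : nat, (-1) ^+ t * `|c| = c.
  by exists (c < 0)%R; rewrite -numEsign.
have [U cliffU ghzE] := ghz_stab t n_gt0.
pose e x : nat := (x == idx0 n) + (x == idx1 n).
pose q0 x := p x - `|c| *+ e x.
have e0 : e (idx0 n) = 1%N by rewrite /e eqxx (negbTE neq01).
have e1 : e (idx1 n) = 1%N by rewrite /e eqxx eq_sym (negbTE neq01).
have erest x : x != idx0 n -> x != idx1 n -> q0 x = p x.
  by rewrite /q0 /e => /negbTE-> /negbTE->; rewrite subr0.
(* Index [ord0] carries the GHZ state; the lifted indices carry the basis states. *)
exists (fun j => if unlift ord0 j is Some x then q0 x else 2 * `|c|).
exists (fun j => if unlift ord0 j is Some x
                 then pauli R (xpauli (fun k : 'I_n => bit x k)) else U).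
have split01 (V : nmodType) (G : 'I_(qdim n) -> V) : \sum_x G x =
    G (idx0 n) + G (idx1 n) + \sum_(x | (x != idx0 n) && (x != idx1 n)) G x.
  by rewrite [LHS](bigD1 (idx0 n)) //= [X in _ + X](bigD1 (idx1 n)) 1?eq_sym //= addrA.
have q_idx0 : q0 (idx0 n) = p (idx0 n) - `|c| by rewrite /q0 e0.
have q_idx1 : q0 (idx1 n) = p (idx1 n) - `|c| by rewrite /q0 e1.
(* F will be the identity for the total weight and the absolute value for the l1-norm. *)
have sum_q (F : R -> R) : \sum_x F (q0 x) = F (p (idx0 n) - `|c|) + F (p (idx1 n) - `|c|) +
    \sum_(x | (x != idx0 n) && (x != idx1 n)) F (p x).
  rewrite split01.
  rewrite q_idx0 q_idx1; congr (_ + _).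
  by apply: eq_bigr => x /andP[x0 x1]; rewrite erest.
have := sum_p; rewrite split01 => sum_pE.
split.
- move=> j; case: unliftP => [x _|_] //; exact: pauli_clifford.
- rewrite big_ord_recl unlift_none ghzE.
  under eq_bigr => x _ do rewrite liftK basis_stab_dm.
  rewrite /rho_pc !split01 q_idx0 q_idx1.
  under [X in _ = _ + (_ + X)]eq_bigr => x /andP[x0 x1] do rewrite erest //.
  have half : (2 * `|c|)%:C * 2^-1 = `|c|%:C :> C.
    by rewrite rmorphM rmorph_nat mulrAC mulfV ?mul1r ?pnatr_eq0.
  have cE : c%:C = (-1) ^+ t * `|c|%:C by rewrite -{1}ct rmorphM rmorph_sign.
  rewrite scalerA half cE !rmorphB; move: (\sum_(_ | _) _) => S.
  by apply/matrixP => i j; rewrite !mxE; ring.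
- rewrite big_ord_recl unlift_none.
  under eq_bigr => x _ do rewrite liftK.
  by rewrite (sum_q id); lra.
- rewrite big_ord_recl unlift_none.
  under eq_bigr => x _ do rewrite liftK.
  rewrite (sum_q Num.norm).
  under eq_bigr => x _ do rewrite ger0_norm //.
  move: sum_pE; move: (\sum_(_ | _) _) => rest.
  have := p_ge0 (idx0 n); have := p_ge0 (idx1 n); have := normr_ge0 c.
  move: le_c; rewrite -real_normK ?num_real //.
  rewrite [`|2 * _|]ger0_norm ?mulr_ge0 //.
  move: `|c| (p (idx0 n)) (p (idx1 n)) => d p0 p1 le_d d_ge0 p1_ge0 p0_ge0 sum_pE.
  (* The weights sum to 1, so a single negative weight p - d raises the l1-norm to 1 + 2(d - p).
     Both being negative would force p0 p1 < c^2. *)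
  have [A|A] := leP d p0; have [B|B] := leP d p1.
  + by rewrite max_l ?ge_max ?subr_le0 ?A ?B // !ger0_norm ?subr_ge0 //; lra.
  + have -> : Num.max (d - p0) (d - p1) = d - p1 by apply: max_r; lra.
    rewrite max_r ?subr_ge0 1?ltW // (ger0_norm (x := p0 - d)) ?subr_ge0 //.
    by rewrite ltr0_norm ?subr_lt0 //; lra.
  + have -> : Num.max (d - p0) (d - p1) = d - p0 by apply: max_l; lra.
    rewrite max_r ?subr_ge0 1?ltW // (ger0_norm (x := p1 - d)) ?subr_ge0 //.
    by rewrite ltr0_norm ?subr_lt0 //; lra.
  + by have := ltr_pM p0_ge0 p1_ge0 A B; rewrite -expr2 ltNge le_d.
- move=> le_min j; case: unliftP => [x _|_]; last by rewrite mulr_ge0.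
  move: le_min; rewrite le_min => /andP[le0 le1].
  have [->|x0] := eqVneq x (idx0 n); first by rewrite /q0 e0 subr_ge0.
  have [->|x1] := eqVneq x (idx1 n); first by rewrite /q0 e1 subr_ge0.
  by rewrite erest.
Qed.

End Robustness.

(** * Membership in the polytope and the value of the robustness *)

Theorem theoremS1 (R : realType) (n : nat) (p : 'I_(qdim n) -> R) (c : R) :
  (1 <= n)%N ->
  (forall x, 0 <= p x) ->
  \sum_(x < qdim n) p x = 1 ->
  c ^+ 2 <= p (idx0 n) * p (idx1 n) ->
  (in_stab_polytope (rho_pc p c) <-> `|c| <= Num.min (p (idx0 n)) (p (idx1 n)))
  /\ is_robustness (rho_pc p c)
       ((1 + 2 * Num.max 0 (Num.max (`|c| - p (idx0 n)) (`|c| - p (idx1 n))))%:C).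
Proof.
move=> n_gt0 p_ge0 sum_p le_c.
have neq01 := idx0_neq_idx1 n_gt0.
have [q [U [cliffU rhoE sum_q norm_q q_ge0]]] := rho_pc_decomp n_gt0 p_ge0 sum_p le_c.
have [rho01 rho10 rho00 rho11] : [/\ rho_pc p c (idx0 n) (idx1 n) = c%:C,
    rho_pc p c (idx1 n) (idx0 n) = c%:C, rho_pc p c (idx0 n) (idx0 n) = (p (idx0 n))%:C &
    rho_pc p c (idx1 n) (idx1 n) = (p (idx1 n))%:C].
  split; rewrite rho_pcE !eqxx ?[idx1 n == _]eq_sym (negbTE neq01) /=;
    by rewrite ?addr0 ?add0r ?mulr1 ?mulr0 ?addr0.
have lower r : robust_decomp (rho_pc p c) r ->
    (1 + 2 * Num.max 0 (Num.max (`|c| - p (idx0 n)) (`|c| - p (idx1 n))))%:C <= r.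
  move=> dec.
  (* The witness takes the sign of c, so that the two coherences contribute 2|c|. *)
  have ct : (-1) ^+ (c < 0)%R * c = `|c| by rewrite normrEsign.
  have wit x y : x != y -> rho_pc p c x y = c%:C -> rho_pc p c y x = c%:C ->
      rho_pc p c x x = (p x)%:C -> (1 + 2 * (`|c| - p x))%:C <= r.
    move=> neq_xy xy yx xx.
    have := robust_decomp_witness (fun U => coherence_witness_stab (c < 0)%R neq_xy) dec.
    rewrite coherence_witnessE xy yx xx mxtrace_rho_pc // sum_p; apply: le_trans.
    rewrite (_ : _ - _ = (1 + 2 * (`|c| - p x))%:C); last first.
      rewrite -ct rmorphD rmorphM rmorphB rmorphM rmorph_sign rmorph_nat rmorph1; ring.
    by rewrite real_ler_norm // complex_real.
  (* If neither excess is positive, the identity is the witness and the bound is tr rho = 1;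
     otherwise the larger excess decides which of 0^n and 1^n is singled out. *)
  have [m0|m0] := leP (Num.max (`|c| - p (idx0 n)) (`|c| - p (idx1 n))) 0.
    have := @robust_decomp_witness _ _ 1%:M _ _ _ dec.
    rewrite mul1mx mxtrace_rho_pc // sum_p normr1 mulr0 addr0; apply => V cliffV.
    by rewrite mul1mx mxtrace_stab_dm ?normr1.
  have [m1|m1] := leP (`|c| - p (idx0 n)) (`|c| - p (idx1 n)).
    by apply: (wit _ (idx0 n)); rewrite // eq_sym.
  by apply: (wit _ (idx1 n)).
split; last first.
  split=> //; exists (qdim n).+1, (fun j => (q j)%:C), (fun j => stab_dm (U j)).
  split=> [j|]; first by rewrite complex_real.
  split=> [j|]; first exact: stab_dm_in_polytope.
  split=> //; rewrite -norm_q rmorph_sum; apply: eq_bigr => j _.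
  by rewrite normc_def /= expr0n addr0 sqrtr_sqr.
split=> [rhoS | le_min].
  (* A point of the polytope is its own decomposition of norm 1, so the lower bound forces the
     maximum to vanish. *)
  have : robust_decomp (rho_pc p c) 1.
    exists 1%N, (fun=> 1), (fun=> rho_pc p c).
    by rewrite !big_ord1 scale1r normr1.
  move/lower; rewrite -(rmorph1 (real_complex R)) lecR gerDl pmulr_rle0 //.
  by rewrite !ge_max le_min !subr_le0 => /andP[_].
exists (qdim n).+1, (fun j => (q j)%:C), U.
split=> [j|]; first by rewrite ler0c q_ge0.
by split=> //; rewrite -rmorph_sum sum_q.
Qed.
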